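(* Let $\mathcal{A}$ be a set of $m$ agents and $\mathcal{B}$ a set of $n$ tasks, $\mathcal{A}\cap\mathcal{B}=\emptyset$, $m\ge n\ge1$, and let $\mathcal{G}_b=(\mathcal{V}_b,\mathcal{E}_b)$ be the complete bipartite graph with $\mathcal{V}_b=\mathcal{A}\cup\mathcal{B}$, with edge weights, in the distributed setting described in the context. Let $\mathcal{E}'\subseteq\mathcal{E}_b$, let $\mathcal{M}\subseteq\mathcal{E}'$ be a maximum cardinality matching (MCM) of $\mathcal{G}_b$, let $\bar e=\{\bar i,\bar j\}\in\mathcal{M}$ with $\bar i\in\mathcal{A}$, $\bar j\in\mathcal{B}$, and put $\bar{\mathcal{M}}=\mathcal{M}\setminus\{\bar e\}$ and $\bar{\mathcal{E}}=\mathcal{E}'\setminus\{\bar e\}$. Then $\mathrm{AugBFS}(\bar e,\bar{\mathcal{M}},(\mathcal{V}_b,\bar{\mathcal{E}}))$, as defined in the context, determines whether there is an augmenting path relative to $\bar{\mathcal{M}}$ contained in $\bar{\mathcal{E}}$: if such a path exists, it returns an MCM $\mathcal{M}_\nu=\bar{\mathcal{M}}\oplus\mathcal{P}$ of $\mathcal G_b$ for some augmenting path $\mathcal{P}\subseteq\bar{\mathcal{E}}$ relative to $\bar{\mathcal{M}}$; if no such path exists, it returns $\mathcal{M}_\nu=\bar{\mathcal{M}}$.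
   Context: $\oplus$ is symmetric difference. A *path* is the edge set $\{\{v_k,v_{k+1}\}\mid1\le k\le l\}$ of a sequence of distinct vertices with consecutive vertices adjacent. It is *alternating* relative to a matching $\mathcal{M}$ if each vertex incident to an edge of it is incident to at most one of its edges in $\mathcal{M}$ and at most one of its edges not in $\mathcal{M}$. A vertex is *free* if no edge of the matching is incident to it. An *augmenting path* is an alternating path whose two (distinct) end vertices are free. **Distributed setting.** Each agent $i$ has access to its incident edges $\{i,j\}$, $j\in\mathcal{B}$, and their weights. Agents share a global clock and at each time step exchange local information (or relay information received earlier) with their neighbours in a time-invariant, undirected, connected communication graph on $\mathcal{A}$. Matchings are stored jointly: agent $i$ stores its matched task $m_i$, with $m_i=-1$ if $i$ is free ($-1$ is a symbol not in $\mathcal{A}\cup\mathcal{B}$). **AugBFS** (a distributed breadth-first search exploring several agents per iteration). $F\leftarrow\emptyset$ (explored agents); $m_i$ is the task matched to $i$ in $\bar{\mathcal{M}}$ (or $-1$); $\mathcal{R}\leftarrow\emptyset$; $\bar{\mathcal{B}}\leftarrow\{\bar j\}$ (current tasks). Repeat until the search is complete: 1. $\bar S\leftarrow\{i\in\mathcal{A}\mid i\notin F\text{ and }\{i,j\}\in\bar{\mathcal{E}}\text{ for some }j\in\bar{\mathcal{B}}\}$; $F\leftarrow F\cup\bar S$. 2. For every $i\in\bar S$ choose $\nu_i\in\{j\in\bar{\mathcal{B}}\mid\{i,j\}\in\bar{\mathcal{E}}\}$ (arbitrarily). 3. Add to $\mathcal{R}$, for every $i\in\bar S$, the edge $\{i,\nu_i\}$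 and, if $m_i\ne-1$, the edge $\{i,m_i\}$. 4. $\bar{\mathcal{B}}\leftarrow\{m_i\mid i\in\bar S\}$. 5. If $\bar S=\emptyset$: set $\mathcal{M}_\nu\leftarrow\bar{\mathcal{M}}$; the search is complete. Otherwise, if some $i\in\bar S$ has $m_i=-1$: choose such an agent $a_f$, let $\mathcal{P}$ be the path between $a_f$ and $\bar j$ consisting of edges of $\mathcal{R}$, and set $\mathcal{M}_\nu\leftarrow\bar{\mathcal{M}}\oplus\mathcal{P}$; the search is complete. Return $\mathcal{M}_\nu$. In the distributed implementation each explored agent $i$ stores its parent $\nu_i$, child $m_i$ and its set of descendant tasks, and communicates $(\nu_i,m_i)$ to all agents (a free agent $a_f$ communicates only $\nu_{a_f}$). *)

(* Defs.v *)
From Stdlib Require Export Relation_Operators.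
From mathcomp Require Export all_boot all_order all_algebra.

Set Implicit Arguments.
Unset Strict Implicit.
Unset Printing Implicit Defensive.

Section Matchings.

(* Agents and tasks are disjoint: the vertex set is the disjoint sum A + B,
   and an edge is the set of its two end vertices. *)
Variables A B : finType.
Local Notation vertex := (A + B)%type.
Local Notation edge := {set (A + B)}.

Definition bedge (i : A) (j : B) : edge := [set inl i; inr j].

Definition complete_edges : {set edge} := [set bedge i j | i : A, j : B].

Definition matching (M : {set edge}) : Prop :=
  M \subset complete_edges /\ trivIset M.

Definition MCM (M : {set edge}) : Prop :=
  matching M /\ forall M' : {set edge}, matching M' -> #|M'| <= #|M|.

Definition symdiff (X Y : {set edge}) : {set edge} := (X :\: Y) :|: (Y :\: X).

Definition adjacent : rel vertex := fun u v => [set u; v] \in complete_edges.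

(* Edges of the vertex sequence x :: s. *)
Definition seq_edges (x : vertex) (s : seq vertex) : {set edge} :=
  [set e in pairmap (fun u v => [set u; v]) x s].

Definition path_between (x y : vertex) (P : {set edge}) : Prop :=
  exists s : seq vertex,
    [/\ path adjacent x s, uniq (x :: s), last x s = y & P = seq_edges x s].

Definition alternating (M P : {set edge}) : Prop :=
  forall v : vertex, v \in cover P ->
    #|[set e in P | (v \in e) && (e \in M)]| <= 1 /\
    #|[set e in P | (v \in e) && (e \notin M)]| <= 1.

Definition free_vertex (M : {set edge}) (v : vertex) : Prop :=
  forall e : edge, e \in M -> v \notin e.

Definition augmenting_path (M P : {set edge}) : Prop :=
  exists x y : vertex,
    [/\ path_between x y P, x != y, alternating M P,
        free_vertex M x & free_vertex M y].

End Matchings.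

(* A communication graph on the agents: undirected, connected, and, being a
   single relation, time-invariant. *)
Definition communication_graph (A : finType) (comm : rel A) : Prop :=
  [/\ symmetric comm, irreflexive comm & forall i k : A, connect comm i k].

Section AugBFS.

Variables A B : finType.
Local Notation edge := {set (A + B)}.

(* The task m_i stored by agent i; None plays the role of the symbol -1. *)
Definition mate (M : {set edge}) (i : A) : option B :=
  [pick j | bedge i j \in M].

(* Searching F R T: at the start of an iteration, F is the set of explored
   agents, R the set of recorded edges, T the set of current tasks.
   Tracing R af: the free agent af has been chosen and the path is to be read
   off R. Returned M: the search is complete with output M. *)
Inductive config :=
  | Searching of {set A} & {set edge} & {set B}
  | Tracing of {set edge} & A
  | Returned of {set edge}.

Variables (jbar : B) (Mbar Ebar : {set edge}).

Definition frontier (F : {set A}) (T : {set B}) : {set A} :=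
  [set i | (i \notin F) && [exists j in T, bedge i j \in Ebar]].

(* Only the values of nu on S are meaningful. *)
Definition parent_choice (S : {set A}) (T : {set B}) (nu : A -> B) : Prop :=
  forall i, i \in S -> nu i \in T /\ bedge i (nu i) \in Ebar.

Definition record_edges (R : {set edge}) (S : {set A}) (nu : A -> B) :
    {set edge} :=
  R :|: [set bedge i (nu i) | i in S]
    :|: [set e | [exists i in S, exists j,
                    (mate Mbar i == Some j) && (e == bedge i j)]].

(* {m_i | i in S} without the symbol -1, which occurs only when the search
   completes in the current iteration. *)
Definition children (S : {set A}) : {set B} :=
  [set j | [exists i in S, mate Mbar i == Some j]].

(* The arbitrary choices (the parents nu, the free agent af) make this a
   relation. "The path between af and jbar in the recorded edges" is a definite
   description: Tracing R af is stuck unless there is exactly one such path,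
   which is why choosing nu and af is a step separate from reading it off. *)
Inductive augbfs_step : config -> config -> Prop :=
  | step_exhausted F R T :
      frontier F T = set0 ->
      augbfs_step (Searching F R T) (Returned Mbar)
  | step_explore F R T nu :
      parent_choice (frontier F T) T nu ->
      frontier F T != set0 ->
      (forall i, i \in frontier F T -> mate Mbar i <> None) ->
      augbfs_step (Searching F R T)
                  (Searching (F :|: frontier F T)
                             (record_edges R (frontier F T) nu)
                             (children (frontier F T)))
  | step_choose_free F R T nu (af : A) :
      parent_choice (frontier F T) T nu ->
      af \in frontier F T -> mate Mbar af = None ->
      augbfs_step (Searching F R T)
                  (Tracing (record_edges R (frontier F T) nu) af)
  | step_augment (R : {set edge}) (af : A) (P : {set edge}) :
      unique (fun Q => path_between (inl af) (inr jbar) Q /\ Q \subset R) P ->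
      augbfs_step (Tracing R af) (Returned (symdiff Mbar P)).

Definition augbfs_start : config := Searching set0 set0 [set jbar].

Definition augbfs_reaches : config -> Prop :=
  clos_refl_trans config augbfs_step augbfs_start.

Definition augbfs_returns (Mnu : {set edge}) : Prop :=
  augbfs_reaches (Returned Mnu).

(* Whatever the choices, an execution is finite and never gets stuck before
   returning. *)
Definition augbfs_terminates : Prop :=
  Acc (fun c' c => augbfs_step c c') augbfs_start /\
  forall c, augbfs_reaches c ->
    (exists Mnu, c = Returned Mnu) \/ (exists c', augbfs_step c c').

End AugBFS.

(* Main.v *)
(* The edges recorded by the search form a tree rooted at [jbar] in which every
   explored agent hangs below its parent task and every explored task below its
   mate. The root path of a free agent is the only simple path to [jbar] among
   the recorded edges, and it alternates, so it is augmenting; flipping it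
   restores the cardinality of the MCM. As [#|A| >= #|B|], an MCM covers all
   tasks, so [jbar] is the only free task; when the search is exhausted without
   meeting a free agent, no augmenting path can enter or leave the explored
   vertices. *)

From Stdlib Require Import Operators_Properties.
Require Import Defs.
From mathcomp Require Import all_boot all_order all_algebra.

Set Implicit Arguments.
Unset Strict Implicit.
Unset Printing Implicit Defensive.

(** * Matchings and alternating paths in the complete bipartite graph *)

Section Paths.

Variables A B : finType.
Local Notation vertex := (A + B)%type.
Local Notation edge := {set (A + B)}.
Implicit Types (M P : {set edge}) (x y v : vertex) (s : seq vertex).

Lemma bedge_inj (i i' : A) (j j' : B) :
  bedge i j = bedge i' j' -> i = i' /\ j = j'.
Proof.
move=> eq_e; split.
- have: inl i \in bedge i' j' by rewrite -eq_e !inE eqxx.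
  by rewrite !inE orbF => /eqP[].
- have: inr j \in bedge i' j' by rewrite -eq_e !inE eqxx.
  by rewrite !inE => /eqP[].
Qed.

Lemma mem_complete (i : A) (j : B) : bedge i j \in complete_edges A B.
Proof. by apply/imset2P; exists i j. Qed.

Lemma adjacentE x y :
  adjacent x y = match x, y with inl _, inr _ | inr _, inl _ => true
                               | _, _ => false end.
Proof.
rewrite /adjacent; apply/imset2P/idP => [[i j _ _ /setP eq_e]|].
  have := eq_e (inl i); have := eq_e (inr j).
  rewrite !inE !eqxx /=.
  by case: x eq_e => ?; case: y => ? eq_e.
case: x y => [i|j] [i'|j'] // _; first by exists i j'.
by exists i' j; rewrite // setUC.
Qed.

Lemma seq_edges_cons x y s :
  seq_edges x (y :: s) = [set x; y] |: seq_edges y s.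
Proof. by apply/setP => e; rewrite !inE. Qed.

Lemma seq_edges_nil x : seq_edges x [::] = set0.
Proof. by apply/setP => e; rewrite !inE. Qed.

Lemma seq_edges_mem x s e v : e \in seq_edges x s -> v \in e -> v \in x :: s.
Proof.
elim: s x => [|y s IHs] x; first by rewrite seq_edges_nil inE.
rewrite seq_edges_cons in_setU1 => /orP[/eqP->|es ve].
  by rewrite !inE => /orP[]->; rewrite ?orbT.
by rewrite inE (IHs y) ?orbT.
Qed.

Lemma matching_eq M e f v :
  matching M -> e \in M -> f \in M -> v \in e -> v \in f -> e = f.
Proof.
move=> [_ /trivIsetP trM] eM fM ve vf; apply/eqP/negPn/negP => ne_ef.
have /pred0P/(_ v) := trM e f eM fM ne_ef.
by rewrite /= ve vf.
Qed.

Lemma matching_sub M M' : matching M -> M' \subset M -> matching M'.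
Proof.
move=> [subM trM] subM'; split; first exact: subset_trans subM.
exact: trivIsetS trM.
Qed.

Lemma matching_add M (i : A) (j : B) :
  matching M -> free_vertex M (inl i) -> free_vertex M (inr j) ->
  matching (bedge i j |: M) /\ #|bedge i j |: M| = #|M|.+1.
Proof.
move=> [subM trM] fi fj.
have eM : bedge i j \notin M.
  by apply/negP => /fi; rewrite !inE eqxx.
split; last by rewrite cardsU1 eM.
split; first by rewrite subUset sub1set mem_complete.
have disj e : e \in M -> [disjoint bedge i j & e].
  move=> in_M; rewrite disjoint_subset; apply/subsetP => v.
  by rewrite !inE => /orP[]/eqP->; [apply: fi | apply: fj].
apply/trivIsetP => e f /setU1P[->|eM'] /setU1P[->|fM']; rewrite ?eqxx //.
- by move=> _; apply: disj.
- by move=> _; rewrite disjoint_sym; apply: disj.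
- by move/trivIsetP: trM; apply.
Qed.

Lemma mateP M i j : matching M -> (mate M i == Some j) = (bedge i j \in M).
Proof.
move=> matM; rewrite /mate; case: pickP => [j' j'M|noM]; last by rewrite noM.
apply/eqP/idP => [[<-]//|jM].
have := matching_eq matM j'M jM (v := inl i).
by rewrite !inE eqxx => /(_ isT isT) /bedge_inj[_ ->].
Qed.

Lemma mate_inj M i i' j :
  matching M -> mate M i = Some j -> mate M i' = Some j -> i = i'.
Proof.
move=> matM /eqP; rewrite mateP // => iM /eqP; rewrite mateP // => iM'.
have := matching_eq matM iM iM' (v := inr j).
by rewrite !inE eqxx orbT => /(_ isT isT) /bedge_inj[].
Qed.

Lemma mate_None_free M i :
  matching M -> mate M i = None <-> free_vertex M (inl i).
Proof.
move=> matM; split=> [noM e eM|fi].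
  have /imset2P[i' j _ _ def_e] := subsetP (proj1 matM) e eM.
  apply/negP; rewrite def_e !inE orbF => /eqP[eq_i].
  by move: eM; rewrite def_e -eq_i -mateP // noM.
case Dj: (mate M i) => [j|] //.
move/eqP: Dj; rewrite mateP // => /fi.
by rewrite !inE eqxx.
Qed.

(** Form of [alternating] suited to induction along a path: [b] is the colour of the first edge,
    true meaning matched. The two notions are linked below for simple sequences. *)
Fixpoint alternates M (b : bool) x s :=
  if s is y :: s' then (([set x; y] \in M) == b) && alternates M (~~ b) y s'
  else true.

Lemma alternating_sub M P P' :
  P' \subset P -> alternating M P -> alternating M P'.
Proof.
move=> subP altP v /bigcupP[e eP' ve].
have vP : v \in cover P by apply/bigcupP; exists e => //; apply: (subsetP subP).
have [le1 le2] := altP v vP.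
have leq_sub (Q : pred edge) : #|[set e in P' | Q e]| <= #|[set e in P | Q e]|.
  apply/subset_leq_card/subsetP => f.
  by rewrite !inE => /andP[/(subsetP subP)->].
by split; [apply: leq_trans le1 | apply: leq_trans le2]; apply: leq_sub.
Qed.

(** Consecutive edges share the middle vertex [y] and differ because [x] does not recur, so the two
    bounds at [y] forbid equal colours. *)
Lemma alternating_alternates M x y s :
  uniq [:: x, y & s] -> alternating M (seq_edges x (y :: s)) ->
  alternates M ([set x; y] \in M) x (y :: s).
Proof.
elim: s x y => [|z s IHs] x y; first by rewrite /= eqxx.
move=> uniq_s altP.
suff col : ([set y; z] \in M) = ~~ ([set x; y] \in M).
  have altP' : alternating M (seq_edges y (z :: s)).
    by apply: alternating_sub altP; rewrite (seq_edges_cons x) subsetUr.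
  have := IHs y z _ altP'; rewrite col /= !eqxx /=; apply.
  by case/andP: uniq_s.
have ne_e : [set x; y] != [set y; z].
  apply/eqP => /setP/(_ x); rewrite !inE eqxx /=.
  by move: uniq_s; rewrite /= !inE !negb_or => /andP[/and3P[/negPf-> /negPf->]].
have xyP : [set x; y] \in seq_edges x [:: y, z & s].
  by rewrite seq_edges_cons !inE eqxx.
have yzP : [set y; z] \in seq_edges x [:: y, z & s].
  by rewrite !seq_edges_cons !inE eqxx orbT.
have yP : y \in cover (seq_edges x [:: y, z & s]).
  by apply/bigcupP; exists [set x; y]; rewrite // !inE eqxx orbT.
have [le1 le2] := altP y yP.
have two (Q : pred edge) :
    #|[set e in seq_edges x [:: y, z & s] | (y \in e) && Q e]| <= 1 ->
    Q [set x; y] -> Q [set y; z] -> False.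
  move=> /card_le1_eqP le Q1 Q2; move/eqP: ne_e; apply; apply: le.
    by apply/setIdP; split=> //; rewrite /= Q2 !inE eqxx.
  by apply/setIdP; split=> //; rewrite /= Q1 !inE eqxx orbT.
case: (boolP ([set x; y] \in M)) (boolP ([set y; z] \in M)) => Q1 [] Q2 //.
- by case: (two _ le1 Q1 Q2).
- by case: (two _ le2 Q1 Q2).
Qed.

Lemma alternates_alternating M b x s :
  uniq (x :: s) -> alternates M b x s -> alternating M (seq_edges x s).
Proof.
move=> uniq_s alt_s.
(* Strengthened for the induction: the start [x] meets no edge of the colour opposite to [b], which
   leaves room for one more edge when the sequence is extended in front. *)
suff le1 v c : #|[set e in seq_edges x s | (v \in e) && ((e \in M) == c)]|
               <= ~~ ((v == x) && (c == ~~ b)).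
  move=> v _; have := (le1 v true, le1 v false).
  have le_b (a : bool) : a <= 1 by case: a.
  case=> /leq_trans/(_ (le_b _)) le_t /leq_trans/(_ (le_b _)) le_f; split.
    by apply: leq_trans le_t; apply/subset_leq_card/subsetP => e;
       rewrite !inE eqb_id.
  by apply: leq_trans le_f; apply/subset_leq_card/subsetP => e;
     rewrite !inE eqbF_neg.
elim: s x b uniq_s alt_s => [|y s IHs] x b.
  move=> _ _; rewrite (_ : [set _ in _ | _] = set0) ?cards0 //.
  by apply/setP => e; rewrite seq_edges_nil !inE.
move=> /= /andP[x_s uniq_s] /andP[/eqP col alt_s].
have IH := IHs y _ uniq_s alt_s; rewrite negbK in IH.
have xnotin e : e \in seq_edges y s -> x \notin e.
  by move=> es; apply: contra x_s; apply: seq_edges_mem es.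
set X := [set _ in _ | _].
have subX : X \subset [set e in [set [set x; y]] | (v \in e) && (b == c)]
         :|: [set e in seq_edges y s | (v \in e) && ((e \in M) == c)].
  apply/subsetP => e; rewrite /X seq_edges_cons !inE.
  case: (e =P [set x; y]) => [->|_] /=; last by move=> /and3P[-> -> ->].
  by rewrite !inE col => /andP[-> ->].
case: (v =P x) => [Dv|ne_vx] /=.
- have -> : X = [set e in [set [set x; y]] | b == c].
    apply/setP=> e; rewrite /X seq_edges_cons !inE Dv.
    case: (e =P [set x; y]) => [->|_] /=; first by rewrite !inE eqxx col.
    apply/negP => /and3P[es xe _]; have := xnotin e.
    by rewrite !inE es xe => /(_ isT).
  case: (b =P c) => [->|/eqP ne_bc].
    rewrite (_ : c == ~~ c = false); last by case: (c).
    rewrite (_ : [set _ in _ | _] = [set [set x; y]]) ?cards1 //.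
    by apply/setP => e; rewrite !inE andbT.
  rewrite (_ : [set _ in _ | _] = set0) ?cards0 //.
  by apply/setP => e; rewrite !inE andbF.
- apply: leq_trans (subset_leq_card subX) _.
  case: (boolP ((v == y) && (b == c))) => [/andP[/eqP vy /eqP bc]|nvb].
    apply: leq_trans (leq_card_setU _ _).1 _.
    rewrite vy bc !eqxx /= leqn0 in IH; rewrite vy (eqP IH) addn0.
    rewrite -(cards1 [set x; y]); apply/subset_leq_card/subsetP => e.
    by rewrite !inE => /and3P[].
  apply: leq_trans (leq_b1 _); apply: leq_trans IH.
  apply/subset_leq_card; rewrite subUset subxx andbT; apply/subsetP => e.
  rewrite !inE => /and3P[/eqP->]; rewrite !inE.
  by case: (v =P x) => // _ /= vy bc; rewrite vy bc in nvb.
Qed.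

(** The last edge touches a free vertex, so it is unmatched, and alternation carries its colour back
    to the first edge. The number of edges is [size s] plus one. *)
Lemma alternates_odd M b x y s :
  alternates M b x (y :: s) -> free_vertex M (last y s) ->
  odd (size s) = b.
Proof.
elim: s b x y => [|z s IHs] b x y /=.
  case: eqP => //= <- _ fy; case: (boolP (_ \in M)) => // /fy.
  by rewrite !inE eqxx orbT.
move=> /andP[_ alt_s] fl; rewrite -/(alternates M (~~ b) y (z :: s)) in alt_s.
by rewrite (IHs _ _ _ alt_s fl) negbK.
Qed.

Lemma eq_alternates M M' b x s :
  (forall e, e \in seq_edges x s -> (e \in M) = (e \in M')) ->
  alternates M b x s = alternates M' b x s.
Proof.
elim: s b x => //= y s IHs b x eqM.
rewrite eqM ?seq_edges_cons ?setU11 // IHs // => e es.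
by rewrite eqM // seq_edges_cons setU1r.
Qed.

(* Flipping the first two edges of the path turns [M] into a matching of the
   same size for which the rest of the path is still augmenting. *)
Lemma augment_matching M x s :
  matching M -> path (@adjacent A B) x s -> uniq (x :: s) ->
  alternates M false x s -> odd (size s) ->
  free_vertex M x -> free_vertex M (last x s) ->
  matching (symdiff M (seq_edges x s)) /\
  #|symdiff M (seq_edges x s)| = #|M|.+1.
Proof.
have [k] := ubnP (size s).
elim: k => // k IHk in M x s *.
have add M' u v : matching M' -> adjacent u v ->
   free_vertex M' u -> free_vertex M' v ->
   matching ([set u; v] |: M') /\ #|[set u; v] |: M'| = #|M'|.+1.
  rewrite adjacentE; case: u v => [i|j] [i'|j'] // matM _ fu fv.
    exact: matching_add.
  by rewrite [X in X |: M']setUC; apply: matching_add.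
case: s => [|y [|z s]] //= le_k matM.
  rewrite !andbT => adj _ /eqP/negbT xyM _ fx fy.
  suff -> : symdiff M (seq_edges x [:: y]) = [set x; y] |: M by apply: add.
  apply/setP => e; rewrite seq_edges_cons seq_edges_nil !inE.
  by case: eqP => [->|_]; rewrite ?(negPf xyM) /=; case: (e \in M).
move=> /and3P[adj_xy adj_yz path_s] /and3P[x_s y_s uniq_s].
move=> /and3P[/eqP/negbT xyM yzM alt_s].
rewrite eqb_id in yzM; rewrite negbK => odd_s fx fl.
have adj_ne u v : adjacent u v -> u != v.
  by rewrite adjacentE; case: u v => ? [].
set M1 := M :\ [set y; z].
have f1 u : u \in [set y; z] -> free_vertex M1 u.
  move=> uyz e; rewrite !inE => /andP[/eqP ne_e eM]; apply/negP => ue.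
  by apply: ne_e; apply: matching_eq matM eM yzM ue uyz.
have matM1 : matching M1 by apply: matching_sub matM _; rewrite subsetDl.
have f1x : free_vertex M1 x by move=> e /setD1P[_ /fx].
have f1y : free_vertex M1 y by apply: f1; rewrite !inE eqxx.
have [matM2 cardM2] := add M1 x y matM1 adj_xy f1x f1y.
set M2 := [set x; y] |: M1 in matM2 cardM2.
have {}cardM2 : #|M2| = #|M|.
  by rewrite cardM2 [#|M|](cardsD1 [set y; z]) yzM.
have ynotin e : e \in seq_edges z s -> y \notin e.
  by move=> es; apply: contra y_s; apply: seq_edges_mem es.
(* [M] and [M2] differ only in edges at [y], which the remaining path avoids. *)
have eqM (e : edge) : y \notin e -> (e \in M) = (e \in M2).
  rewrite !inE; case: (e =P [set x; y]) => [->|_ /=].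
    by rewrite !inE eqxx orbT.
  by case: (e =P [set y; z]) => [->|//]; rewrite !inE eqxx.
have -> : symdiff M (seq_edges x [:: y, z & s]) = symdiff M2 (seq_edges z s).
  apply/setP => e; rewrite /symdiff !seq_edges_cons.
  rewrite !in_setU !in_setD !in_setU1 [e \in M1]in_setD1.
  case: (e =P [set x; y]) => [->|_] /=.
    have -> : ([set x; y] \in seq_edges z s) = false.
      by apply/negP => /ynotin; rewrite !inE eqxx orbT.
    by rewrite (negPf xyM).
  case: (e =P [set y; z]) => [->|_] /=; last by rewrite ?andbT.
  have -> : ([set y; z] \in seq_edges z s) = false.
    by apply/negP => /ynotin; rewrite !inE eqxx.
  by rewrite yzM.
rewrite -cardM2; apply: IHk => //.
- exact: ltnW le_k.
- rewrite -(@eq_alternates M) // => e /ynotin; exact: eqM.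
- move=> e /setU1P[->|]; last by apply: f1; rewrite !inE eqxx orbT.
  rewrite !inE negb_or [z == y]eq_sym adj_ne // andbT.
  by apply: contra x_s => /eqP<-; rewrite !inE eqxx orbT.
move=> e /setU1P[->|/setD1P[_ /fl //]].
rewrite !inE negb_or; apply/andP; split.
  by apply: contra x_s => /eqP<-; rewrite inE mem_last orbT.
by apply: contra y_s => /eqP<-; rewrite mem_last.
Qed.


End Paths.

(** * Correctness of the search when [jbar] is the only free task *)

Section Search.

Variables A B : finType.
Local Notation vertex := (A + B)%type.
Local Notation edge := {set (A + B)}.
Variables (jbar : B) (Mbar Ebar : {set edge}).
Implicit Types (F S : {set A}) (T : {set B}) (nu : A -> B) (d : B -> nat).
Implicit Types (i : A) (j : B) (s : seq vertex).

Hypothesis matM : matching Mbar.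
Hypothesis sub_ME : Mbar \subset Ebar.
Hypothesis jbar_free : free_vertex Mbar (inr jbar).
Hypothesis free_jbar : forall j, free_vertex Mbar (inr j) -> j = jbar.

Lemma in_children F j :
  reflect (exists2 i, i \in F & mate Mbar i = Some j) (j \in children Mbar F).
Proof.
rewrite inE; apply: (iffP exists_inP) => [] [i iF /eqP]; first by exists i.
by exists i => //; apply/eqP.
Qed.

Lemma childrenU F S :
  children Mbar (F :|: S) = children Mbar F :|: children Mbar S.
Proof.
apply/setP => j; rewrite in_setU; apply/in_children/orP.
  by case=> i /setUP[] iF mi; [left | right]; apply/in_children; exists i.
by case=> /in_children[i iF mi]; exists i; rewrite // inE iF ?orbT.
Qed.

Lemma mate_jbar i : mate Mbar i <> Some jbar.
Proof.
by move/eqP; rewrite mateP // => /jbar_free; rewrite !inE eqxx.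
Qed.

Lemma in_frontier F T i :
  reflect (i \notin F /\ exists2 j, j \in T & bedge i j \in Ebar)
          (i \in frontier Ebar F T).
Proof. by rewrite inE; apply: (iffP andP) => [] [-> /exists_inP]. Qed.

Lemma in_record_edges (R : {set edge}) S nu e :
  reflect [\/ e \in R, exists2 i, i \in S & e = bedge i (nu i)
            | exists i j, [/\ i \in S, mate Mbar i = Some j & e = bedge i j]]
          (e \in record_edges Mbar R S nu).
Proof.
rewrite !in_setU inE; apply: (iffP idP) => [/orP[/orP[]|]|[]].
- by constructor 1.
- by case/imsetP=> i; constructor 2; exists i.
- case/exists_inP=> i iS /existsP[j /andP[/eqP mi /eqP ->]].
  by constructor 3; exists i, j.
- by move=> ->.
- by case=> i iS ->; rewrite [X in _ || X || _]imset_f // orbT.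
case=> i [j [iS mi ->]]; apply/orP; right; apply/exists_inP; exists i => //.
by apply/existsP; exists j; rewrite mi !eqxx.
Qed.

(** Merges the parent choices of successive iterations, so that one function describes all recorded
    edges, independently of the history of the search. *)
Lemma record_edgesU F S nu nu' nu'' :
  {in F, nu'' =1 nu} -> {in S, nu'' =1 nu'} ->
  record_edges Mbar (record_edges Mbar set0 F nu) S nu' =
  record_edges Mbar set0 (F :|: S) nu''.
Proof.
move=> eqF eqS; apply/setP=> e.
apply/in_record_edges/in_record_edges => [[]|[]].
- case/in_record_edges; first by rewrite inE.
    by case=> i iF ->; constructor 2; exists i; rewrite ?inE ?iF ?eqF.
  by case=> i [j [iF mi ->]]; constructor 3; exists i, j; rewrite inE iF.
- by case=> i iS ->; constructor 2; exists i; rewrite ?inE ?iS ?orbT ?eqS.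
- by case=> i [j [iS mi ->]]; constructor 3; exists i, j; rewrite inE iS orbT.
- by rewrite inE.
- case=> i /setUP[iF|iS] ->; last by constructor 2; exists i; rewrite ?eqS.
  constructor 1; apply/in_record_edges; constructor 2.
  by exists i; rewrite ?eqF.
case=> i [j [/setUP[iF|iS] mi ->]]; last by constructor 3; exists i, j.
by constructor 1; apply/in_record_edges; constructor 3; exists i, j.
Qed.

(** * The tree of recorded edges and its root paths *)

(** The recorded edges, oriented towards the root. Each vertex has at most one successor and [jbar]
    has none, which makes root paths unique. *)
Definition up F nu : rel vertex := fun u v =>
  match u, v with
  | inl i, inr j => (i \in F) && (nu i == j)
  | inr j, inl i => (i \in F) && (mate Mbar i == Some j)
  | _, _ => false
  end.

Lemma up_fun F nu u v v' : up F nu u v -> up F nu u v' -> v = v'.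
Proof.
case: u v v' => [i|j] [i1|j1] [i2|j2] //=.
  by move=> /andP[_ /eqP<-] /andP[_ /eqP<-].
move=> /andP[_ /eqP m1] /andP[_ /eqP m2].
by rewrite (mate_inj matM m1 m2).
Qed.

Lemma up_jbar F nu v : ~~ up F nu (inr jbar) v.
Proof.
case: v => [i|//] /=; apply/negP => /andP[_ /eqP]; exact: mate_jbar.
Qed.

Lemma up_adjacent F nu u v : up F nu u v -> adjacent u v.
Proof. by rewrite adjacentE; case: u v => ? []. Qed.

Lemma up_record F nu u v :
  up F nu u v -> [set u; v] \in record_edges Mbar set0 F nu.
Proof.
move=> uv; apply/in_record_edges; case: u v uv => [i|j] [i'|j'] //=.
  by move=> /andP[iF /eqP<-]; constructor 2; exists i.
by move=> /andP[iF /eqP mi]; constructor 3; exists i', j; rewrite setUC.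
Qed.

Lemma bedge_set2 i j (u v : vertex) :
  adjacent u v -> [set u; v] = bedge i j ->
  u = inl i /\ v = inr j \/ u = inr j /\ v = inl i.
Proof.
rewrite adjacentE; case: u v => [i'|j'] [i''|j''] // _.
  by case/bedge_inj=> -> ->; left.
by rewrite setUC => /bedge_inj[-> ->]; right.
Qed.

Lemma record_up F nu u v :
  adjacent u v -> [set u; v] \in record_edges Mbar set0 F nu ->
  up F nu u v || up F nu v u.
Proof.
move=> uv /in_record_edges[|[i iF]|[i [j [iF mi]]]]; first by rewrite inE.
  by case/bedge_set2=> // [] [-> ->] /=; rewrite iF eqxx ?orbT.
by case/bedge_set2=> // [] [-> ->] /=; rewrite iF mi eqxx ?orbT.
Qed.

(* Parents being unique, a simple path that once moves away from the root never
   turns back. *)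
Lemma up_down_path F nu u v s :
  path (fun a b => up F nu a b || up F nu b a) u (v :: s) ->
  uniq [:: u, v & s] -> up F nu v u -> exists z, up F nu (last v s) z.
Proof.
elim: s u v => [|w s IHs] u v; first by exists u.
move=> /= /andP[_ /andP[vw path_s]] uniq_s vu.
have {}vw : up F nu w v.
  case/orP: vw => // vw.
  by move: uniq_s; rewrite (up_fun vu vw) !inE eqxx orbT.
apply: (IHs v w) => //; last by case/andP: uniq_s.
by rewrite /= vw orbT.
Qed.

(** A first step away from the root would, by [up_down_path], give the last vertex a successor, but
    [jbar] has none. *)
Lemma up_path_root F nu u s :
  path (fun a b => up F nu a b || up F nu b a) u s -> uniq (u :: s) ->
  last u s = inr jbar -> path (up F nu) u s.
Proof.
elim: s u => // v s IHs u path_s uniq_s lst.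
have /= /andP[/orP[uv|vu] path_s'] := path_s.
  by rewrite uv IHs //; case/andP: uniq_s.
have [z] := up_down_path path_s uniq_s vu.
by rewrite [last v s]lst (negPf (up_jbar _ _ _)).
Qed.

Lemma up_path_unique F nu u s s' :
  path (up F nu) u s -> path (up F nu) u s' ->
  last u s = inr jbar -> last u s' = inr jbar -> s = s'.
Proof.
elim: s u s' => [|v s IHs] u [|v' s'] //=.
- by move=> _ /andP[uv _] Du; rewrite Du (negPf (up_jbar _ _ _)) in uv.
- by move=> /andP[uv _] _ _ Du; rewrite Du (negPf (up_jbar _ _ _)) in uv.
move=> /andP[uv path_s] /andP[uv' path_s'] ls ls'.
rewrite -(up_fun uv uv') in path_s' ls' *.
by rewrite (IHs v s').
Qed.

(* [nu] and the mates make the explored agents a tree of edges rooted at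
   [jbar]; the potential [d] excludes cycles. *)
Definition search_tree F nu d : Prop :=
  forall i, i \in F ->
  [/\ bedge i (nu i) \in Ebar, nu i \in jbar |: children Mbar F
    & forall j, mate Mbar i = Some j -> d (nu i) < d j].

(** Induction on the potential of the parent task, which drops on passing to the mate of that
    parent; the climb can stop only at [jbar]. *)
Lemma search_tree_path F nu d i :
  search_tree F nu d -> i \in F ->
  exists2 s, path (up F nu) (inl i) s & last (inl i) s = inr jbar.
Proof.
move=> tree; have [k] := ubnP (d (nu i)); elim: k i => // k IHk i le_k iF.
have [_ /setU1P[Dnu _|/in_children[i' i'F mi'] _]] := tree i iF.
  by exists [:: inr jbar]; rewrite //= iF Dnu eqxx.
have [_ _ /(_ _ mi') lt_d] := tree i' i'F.
have [s path_s ls] := IHk i' (leq_trans lt_d le_k) i'F.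
exists [:: inr (nu i), inl i' & s]; rewrite //=.
by rewrite iF i'F mi' !eqxx path_s.
Qed.

(** Extends [d] to a rank of all vertices that drops along every step of [up]. Doubling makes room
    to place a mated agent strictly between its parent task and its own mate; a free agent is placed
    above all tasks. *)
Definition up_rank d (v : vertex) : nat :=
  match v with
  | inr j => (d j).*2.+1
  | inl i => if mate Mbar i is Some j then (d j).*2 else (\max_j d j).*2.+2
  end.

Lemma up_rank_lt F nu d u v :
  search_tree F nu d -> up F nu u v -> up_rank d v < up_rank d u.
Proof.
move=> tree; case: u v => [i|j] [i'|j'] //= /andP[iF /eqP]; last by move=> ->.
move=> <-; have [_ _] := tree i iF; case: (mate Mbar i) => [j|_].
  by move=> /(_ _ erefl) lt_d; rewrite ltn_Sdouble.
by rewrite !ltnS leq_double (leq_bigmax (F := d)).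
Qed.

Lemma up_path_uniq F nu d u s :
  search_tree F nu d -> path (up F nu) u s -> uniq (u :: s).
Proof.
move=> tree path_s.
have: sorted (fun u v => up_rank d v < up_rank d u) (u :: s).
  by apply: sub_path path_s => v w; apply: up_rank_lt tree.
apply: sorted_uniq => [x y z ? /ltn_trans|x]; first exact.
by rewrite ltnn.
Qed.

Lemma up_path_edges F nu u s :
  path (up F nu) u s -> seq_edges u s \subset record_edges Mbar set0 F nu.
Proof.
elim: s u => [|v s IHs] u /=; first by rewrite seq_edges_nil sub0set.
move=> /andP[uv path_s]; rewrite seq_edges_cons subUset sub1set up_record //.
exact: IHs.
Qed.

(** A step from a task to its mate is a matched edge; a step to a parent is unmatched, as the mate
    has larger potential than the parent. *)
Lemma up_path_alternates F nu d u s :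
  search_tree F nu d -> path (up F nu) u s ->
  alternates Mbar (if u is inr _ then true else false) u s.
Proof.
move=> tree; elim: s u => //= v s IHs u /andP[uv path_s].
apply/andP; split.
  case: u v uv {path_s} => [i|j] [i'|j'] //= /andP[iF /eqP].
    move=> <-; rewrite eqbF_neg -[_ \in _](mateP _ _ matM).
    have [_ _ lt_d] := tree i iF; apply/negP => /eqP/lt_d.
    by rewrite ltnn.
  by move=> /eqP; rewrite mateP // setUC => ->.
have := IHs v path_s.
by case: u v uv {path_s} => [i|j] [i'|j'].
Qed.

Lemma record_sub F nu d :
  search_tree F nu d -> record_edges Mbar set0 F nu \subset Ebar.
Proof.
move=> tree; apply/subsetP => e /in_record_edges[|[i iF ->]|[i [j [_ /eqP]]]].
- by rewrite inE.
- by have [] := tree i iF.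
by rewrite mateP // => eM ->; apply: (subsetP sub_ME).
Qed.

Lemma path_record F nu u s :
  path (@adjacent A B) u s ->
  seq_edges u s \subset record_edges Mbar set0 F nu ->
  path (fun a b => up F nu a b || up F nu b a) u s.
Proof.
elim: s u => //= v s IHs u /andP[uv path_s].
rewrite seq_edges_cons subUset sub1set => /andP[uvR sR].
by rewrite record_up // IHs.
Qed.

(** Uniqueness is the premise of [step_augment], so this serves both to show that tracing cannot get
    stuck and to identify what it returns. *)
Lemma search_tree_augment F nu d i :
  search_tree F nu d -> i \in F -> mate Mbar i = None ->
  exists P,
  [/\ unique (fun Q => path_between (inl i) (inr jbar) Q
                       /\ Q \subset record_edges Mbar set0 F nu) P,
      augmenting_path Mbar P, P \subset Ebar, matching (symdiff Mbar P)
    & #|symdiff Mbar P| = #|Mbar|.+1].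
Proof.
move=> tree iF /(mate_None_free _ matM) free_i.
have [s path_s ls] := search_tree_path tree iF.
have uniq_s := up_path_uniq tree path_s.
have adj_s : path (@adjacent A B) (inl i) s.
  by apply: sub_path path_s => u v; apply: up_adjacent.
have sub_s := up_path_edges path_s.
have alt_s : alternates Mbar false (inl i) s := up_path_alternates tree path_s.
have pbw : path_between (inl i) (inr jbar) (seq_edges (inl i) s) by exists s.
(* The path starts with an unmatched edge and ends at the free task [jbar], hence has odd length. *)
have odd_s : odd (size s).
  case: (s) alt_s ls => // v s' alt_s' ls.
  by rewrite /= (alternates_odd alt_s') //= -/(last _ _) [last _ _]ls.
exists (seq_edges (inl i) s).
have [||mat_s card_s] := augment_matching matM adj_s uniq_s alt_s odd_s.
- exact: free_i.
- by rewrite ls.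
split=> //; last exact: subset_trans (record_sub tree).
  split=> // Q [[s' [adj_s' uniq_s' ls' ->]] sub_s'].
  congr seq_edges; apply: (up_path_unique path_s _ ls ls').
  by apply: up_path_root => //; apply: path_record.
exists (inl i), (inr jbar); split=> //.
exact: alternates_alternating alt_s.
Qed.

(** Follow the path two edges at a time. From a free agent, which is unexplored, it visits only
    unexplored agents and cannot end at [jbar]; from [jbar] it visits only reached tasks and
    explored agents, and cannot end at a free agent. *)
Lemma closed_no_augmenting F :
  (forall i, i \in F -> mate Mbar i <> None) ->
  (forall i j, j \in jbar |: children Mbar F -> bedge i j \in Ebar ->
     i \in F) ->
  ~ exists P, augmenting_path Mbar P /\ P \subset Ebar.
Proof.
move=> mated closed [P [[x [y [[s [adj_s uniq_s ls ->] ne_xy alt_s fx fy]]]]]].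
have {alt_s} [alt_s odd_s]: alternates Mbar false x s /\ odd (size s).
  case: s uniq_s ls alt_s adj_s => [_ /eqP|v s]; first by rewrite (negPf ne_xy).
  move=> uniq_s ls /(alternating_alternates uniq_s).
  have /negPf-> : [set x; v] \notin Mbar.
    by apply/negP => /fx; rewrite !inE eqxx.
  move=> alt_s _; split=> //=; rewrite (alternates_odd alt_s) //.
  by rewrite [last v s]ls.
have mate2 i j : [set inr j; inl i] \in Mbar -> mate Mbar i = Some j.
  by rewrite setUC -[_ \in _](mateP _ _ matM) => /eqP.
have mate1 i j : [set inl i; inr j] \in Mbar -> mate Mbar i = Some j.
  by rewrite -[_ \in _](mateP _ _ matM) => /eqP.
(* Both orientations of the path are treated at once: this condition on the current vertex survives
   an unmatched edge followed by a matched one. *)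
have bad : match x with inl i => i \notin F
                      | inr j => j \in jbar |: children Mbar F end.
  case: x adj_s uniq_s ls ne_xy alt_s fx => [i|j] _ _ _ _ _.
    move/(mate_None_free _ matM) => mi; apply/negP => /mated; exact.
  by move/free_jbar->; rewrite setU11.
have {ls} fy : free_vertex Mbar (last x s) by rewrite ls.
(* Freeness of the start is dropped, as it fails for the later vertices of the walk. *)
move: adj_s alt_s odd_s fy bad; clear ne_xy fx uniq_s; move: x.
have [k] := ubnP (size s); elim: k s => // k IHk [|v s] //= le_k x.
move=> /andP[xv adj_s] /andP[_ alt_s] odd_s fy bad.
rewrite seq_edges_cons subUset sub1set => /andP[xvE sub_s].
case: s le_k adj_s alt_s odd_s fy sub_s => [|z s] /= le_k.
  move=> _ _ _ fv _; move: xv bad xvE fv.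
  rewrite adjacentE; case: x v => [i|j] [i'|j'] // _ bad xvE fv.
    move/negP: bad; apply; apply: closed xvE.
    by rewrite (free_jbar fv) setU11.
  rewrite setUC in xvE.
  by have /mated := closed _ _ bad xvE; case; apply/(mate_None_free _ matM).
move=> /andP[vz adj_s] /andP[/eqP vzM alt_s]; rewrite negbK => odd_s fy.
rewrite seq_edges_cons subUset => /andP[_ sub_s].
apply: (IHk s _ z) => //; first exact: ltnW le_k.
move: xv vz vzM xvE bad; rewrite !adjacentE.
case: x v z {alt_s fy adj_s sub_s} => [i|j] [i'|j'] [i''|j''] //= _ _.
  move=> /mate2 m xvE; apply: contra => i''F; apply: closed xvE.
  by rewrite inE; apply/orP; right; apply/in_children; exists i''.
move=> /mate1 m; rewrite setUC => xvE bad.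
rewrite inE; apply/orP; right; apply/in_children; exists i' => //.
exact: closed bad xvE.
Qed.

(** * The invariant of the search and its preservation *)

(** By the last clause of [Searching], reached tasks that are no longer current have only explored
    neighbours; once the frontier is empty this holds for the current ones too, as
    [closed_no_augmenting] requires. The size kept under [Returned] is later compared with that of
    the original MCM. *)
Definition search_invariant (c : config A B) : Prop :=
  match c with
  | Searching F R T =>
      exists nu d,
      [/\ search_tree F nu d, R = record_edges Mbar set0 F nu,
          forall i, i \in F -> mate Mbar i <> None,
          T \subset jbar |: children Mbar F
        & forall i j, j \in (jbar |: children Mbar F) :\: T ->
            bedge i j \in Ebar -> i \in F]
  | Tracing R af =>
      exists F nu d,
      [/\ search_tree F nu d, R = record_edges Mbar set0 F nu, af \in F
        & mate Mbar af = None]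
  | Returned Mnu =>
      (Mnu = Mbar /\ ~ exists P, augmenting_path Mbar P /\ P \subset Ebar)
      \/ exists P, [/\ augmenting_path Mbar P, P \subset Ebar,
           Mnu = symdiff Mbar P, matching Mnu & #|Mnu| = #|Mbar|.+1]
  end.

(** The parents chosen in this iteration are old tasks and the children are new ones, so raising the
    children above all old values gives a potential for the larger tree. *)
Lemma search_tree_extend F T nu nu' d :
  search_tree F nu d -> T \subset jbar |: children Mbar F ->
  parent_choice Ebar (frontier Ebar F T) T nu' ->
  exists nu'' d',
    search_tree (F :|: frontier Ebar F T) nu'' d' /\
    record_edges Mbar (record_edges Mbar set0 F nu) (frontier Ebar F T) nu' =
    record_edges Mbar set0 (F :|: frontier Ebar F T) nu''.
Proof.
move=> tree subT choice_nu; set S := frontier Ebar F T.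
have S_F i : i \in S -> i \notin F by case/in_frontier.
(* Distinct agents have distinct mates and [jbar] is nobody's mate, so no child of a new agent was
   reached before. *)
have new_task j : j \in jbar |: children Mbar F -> j \notin children Mbar S.
  move=> jU; apply/in_children => -[i iS mi]; case/setU1P: jU => [Dj|].
    by apply: (mate_jbar (i := i)); rewrite mi Dj.
  case/in_children=> i' i'F mi'; move/negP: (S_F i iS); apply.
  by rewrite (mate_inj matM mi mi').
pose nu'' i := if i \in S then nu' i else nu i.
pose d' j := if j \in children Mbar S then (\max_j d j).+1 else d j.
have eqF : {in F, nu'' =1 nu}.
  by move=> i iF; rewrite /nu'' ifN //; apply: contraL iF; apply: S_F.
have eqS : {in S, nu'' =1 nu'} by move=> i iS; rewrite /nu'' iS.
exists nu'', d'; split; last exact: record_edgesU.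
move=> i.
case: (boolP (i \in S)) => [iS _|iS /setUP[iF|]]; last by rewrite (negPf iS).
  have [nuT nuE] := choice_nu i iS; rewrite eqS //.
  have nuU := subsetP subT _ nuT.
  split=> // [|j mi]; first by rewrite childrenU setUA inE nuU.
  rewrite /d' (negPf (new_task _ nuU)).
  have -> : j \in children Mbar S by apply/in_children; exists i.
  by rewrite ltnS (leq_bigmax (F := d)).
have [nuE nuU lt_d] := tree i iF; rewrite eqF //.
split=> // [|j mi]; first by rewrite childrenU setUA inE nuU.
rewrite /d' (negPf (new_task _ nuU)) ifN; first exact: lt_d.
by apply/new_task/setU1P; right; apply/in_children; exists i.
Qed.

Lemma search_invariant_step c c' :
  augbfs_step jbar Mbar Ebar c c' -> search_invariant c -> search_invariant c'.
Proof.
case=> [F R T S0|F R T nu' choice_nu _ mated|F R T nu' af choice_nu afS maf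
       |R af P uniqP] /=.
- case=> [nu [d [_ _ mated subT closed]]]; left; split=> //.
  apply: (closed_no_augmenting mated) => i j jU eE.
  (* An unexplored neighbour of a current task would lie in the empty frontier; the other reached
     tasks are covered by the invariant. *)
  case: (boolP (j \in T)) => jT.
    apply/negPn/negP => iF; have: i \in frontier Ebar F T.
      by apply/in_frontier; split=> //; exists j.
    by rewrite S0 inE.
  by apply: closed eE; rewrite inE jT.
- case=> [nu [d [tree -> matedF subT closed]]].
  have [nu'' [d' [tree' ->]]] := search_tree_extend tree subT choice_nu.
  exists nu'', d'; split=> //.
  + by move=> i /setUP[/matedF|/mated].
  + by rewrite childrenU setUA subsetUr.
  (* The tasks to check were reached before this iteration: unexplored neighbours of those in [T]
     lie in the frontier, and the others had none. *)
  move=> i j; rewrite childrenU setUA setDUl setDv setU0.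
  move=> /setDP[jU jS] eE.
  case: (boolP (i \in F)) => iF; first by rewrite inE iF.
  rewrite inE; apply/orP; right; apply/in_frontier; split=> //; exists j => //.
  apply/negPn/negP => jT; move/negP: iF; apply.
  by apply: closed eE; rewrite inE jT.
- case=> [nu [d [tree -> _ subT _]]].
  have [nu'' [d' [tree' ->]]] := search_tree_extend tree subT choice_nu.
  by exists (F :|: frontier Ebar F T), nu'', d'; split; rewrite // inE afS orbT.
case=> F [nu [d [tree DR afF maf]]]; rewrite DR in uniqP; right.
have [Q [[pQ _] augQ subQ matQ cardQ]] := search_tree_augment tree afF maf.
(* By uniqueness the path [P] of the step is the root path [Q]. *)
have [_ /(_ Q pQ) DP] := uniqP.
by exists Q; rewrite DP.
Qed.

Lemma search_invariant_reaches c :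
  augbfs_reaches jbar Mbar Ebar c -> search_invariant c.
Proof.
move=> reach; elim: {reach} (clos_rt_rtn1 _ _ _ _ reach)
  => [|c1 c2 step _]; last exact: search_invariant_step.
(* No agent is explored yet, so any parent function and potential will do. *)
exists (fun=> jbar), (fun=> 0); split.
- by move=> i; rewrite inE.
- apply/setP => e; rewrite inE; apply/esym/in_record_edges => -[].
  + by rewrite inE.
  + by case=> i; rewrite inE.
  by case=> i [j []]; rewrite inE.
- by move=> i; rewrite inE.
- by rewrite subsetUl.
move=> i j /setDP[/setU1P[->|/in_children[i']]]; first by rewrite set11.
by rewrite in_set0.
Qed.

(** * Termination and progress *)

(** Every iteration that continues explores a new agent; the offset 2 leaves the values 1 and 0 for
    tracing and returning. *)
Definition search_measure (c : config A B) : nat :=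
  match c with
  | Searching F _ _ => #|~: F|.+2
  | Tracing _ _ => 1
  | Returned _ => 0
  end.

Lemma search_measure_step c c' :
  augbfs_step jbar Mbar Ebar c c' -> search_measure c' < search_measure c.
Proof.
case=> //= F R T _ _ /set0Pn[i iS] _; rewrite !ltnS; apply: proper_card.
rewrite properE setCS subsetUl setCS; apply/subsetPn; exists i.
  by rewrite inE iS orbT.
by case/in_frontier: iS.
Qed.

Lemma parent_choice_exists F T :
  exists nu, parent_choice Ebar (frontier Ebar F T) T nu.
Proof.
(* [jbar] is only a default value: an agent of the frontier always has a candidate parent. *)
exists (fun i => odflt jbar [pick j in T | bedge i j \in Ebar]) => i.
case/in_frontier=> _ [j jT eE]; case: pickP => [j' /andP[]//|/(_ j)].
by rewrite /= jT eE.
Qed.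

(** A tracing state could get stuck only for want of a unique path, and the tree in the invariant
    supplies one. *)
Lemma search_progress c :
  search_invariant c ->
  (exists Mnu, c = Returned Mnu) \/ exists c', augbfs_step jbar Mbar Ebar c c'.
Proof.
case: c => [F R T _|R af|Mnu]; last by left; exists Mnu.
  right; have [nu choice_nu] := parent_choice_exists F T.
  case: (eqVneq (frontier Ebar F T) set0) => [S0|S_n0].
    by exists (Returned Mbar); apply: step_exhausted.
  case: (pickP [pred i in frontier Ebar F T | mate Mbar i == None]).
    move=> af /andP[afS /eqP maf].
    by eexists; apply: step_choose_free choice_nu afS maf.
  move=> mated; eexists; apply: step_explore choice_nu S_n0 _ => i iS mi.
  by have := mated i; rewrite /= iS mi.
case=> F [nu [d [tree -> afF maf]]]; right.
have [P [uniqP _ _ _ _]] := search_tree_augment tree afF maf.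
by exists (Returned (symdiff Mbar P)); apply: step_augment.
Qed.

Lemma search_terminates : augbfs_terminates jbar Mbar Ebar.
Proof.
split; last by move=> c /search_invariant_reaches/search_progress.
move: (augbfs_start A jbar) => c.
have [k] := ubnP (search_measure c).
elim: k c => [|k IHk] c le_k; first by rewrite ltn0 in le_k.
constructor=> c' /search_measure_step lt_c; apply: IHk.
exact: leq_trans lt_c le_k.
Qed.

End Search.

(* A free task leaves at most [#|B| - 1] tasks to be the distinct mates of the
   [#|A| >= #|B|] agents, so some agent is free as well and can be added. *)
Lemma MCM_saturates_tasks (A B : finType) (M : {set {set (A + B)}}) (j : B) :
  #|B| <= #|A| -> MCM M -> ~ free_vertex M (inr j).
Proof.
move=> le_BA [matM maxM] free_j.
have [i mi|mated] := pickP (fun i => mate M i == None).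
  have /(mate_None_free _ matM) free_i := eqP mi.
  have [mat1 card1] := matching_add matM free_i free_j.
  by have := maxM _ mat1; rewrite card1 ltnn.
(* The default [j] is never taken, since here every agent has a mate. *)
pose f i := odflt j (mate M i).
have mate_f i : mate M i = Some (f i).
  by rewrite /f; case: (mate M i) (mated i).
have f_inj : injective f.
  by move=> i i' eq_f; apply: (mate_inj matM (mate_f i)); rewrite eq_f.
have /subset_leq_card : f @: [set: A] \subset [set~ j].
  apply/subsetP => _ /imsetP[i _ ->]; rewrite !inE; apply/eqP => Df.
  have /eqP := mate_f i; rewrite Df mateP // => /free_j.
  by rewrite !inE eqxx.
rewrite card_imset // cardsT cardsC1 => le_AB.
have := leq_trans le_BA le_AB.
(* Since [j] belongs to [B], the predecessor of [#|B|] is not truncated at 0, so [#|B|] cannot be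
   bounded by it. *)
by rewrite (cardD1 j B) leqNgt inE /= add1n ltnSn.
Qed.

Theorem lemma3
  (m n : nat) (A B : finType)
  (cardA : #|A| = m) (cardB : #|B| = n) (le_nm : n <= m) (n_ge1 : 1 <= n)
  (R : realFieldType) (w : A -> B -> R)
  (comm : rel A) (comm_graph : communication_graph comm)
  (E' M : {set {set (A + B)}}) (ibar : A) (jbar : B)
  (sub_E' : E' \subset complete_edges A B)
  (sub_M : M \subset E') (M_mcm : MCM M)
  (ebar_M : bedge ibar jbar \in M) :
  let Mbar := M :\ bedge ibar jbar in
  let Ebar := E' :\ bedge ibar jbar in
  augbfs_terminates jbar Mbar Ebar /\
  forall Mnu : {set {set (A + B)}}, augbfs_returns jbar Mbar Ebar Mnu ->
    ((exists P, augmenting_path Mbar P /\ P \subset Ebar) ->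
       MCM Mnu /\
       exists P, [/\ augmenting_path Mbar P, P \subset Ebar
                   & Mnu = symdiff Mbar P]) /\
    (~ (exists P, augmenting_path Mbar P /\ P \subset Ebar) -> Mnu = Mbar).
Proof.
move=> Mbar Ebar.
have [matM maxM] := M_mcm.
have matMbar : matching Mbar by apply: matching_sub matM (subsetDl _ _).
have sub_ME : Mbar \subset Ebar by apply: setSD.
have jbar_free : free_vertex Mbar (inr jbar).
  move=> e /setD1P[/eqP ne_e eM]; apply/negP => je; apply: ne_e.
  by apply: matching_eq matM eM ebar_M je _; rewrite !inE eqxx orbT.
(* A second task free for [Mbar] would be free for [M] too, since the removed edge covers no task
   but [jbar]; an MCM leaves no task free. *)
have free_jbar j : free_vertex Mbar (inr j) -> j = jbar.
  move=> free_j; apply/eqP/negPn/negP => ne_j.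
  have le_BA : #|B| <= #|A| by rewrite cardA cardB.
  apply: (MCM_saturates_tasks le_BA M_mcm (j := j)) => e eM.
  case: (eqVneq e (bedge ibar jbar)) => [->|ne_e].
    by rewrite !inE /=; apply: contra ne_j => /eqP[->].
  by apply: free_j; rewrite !inE ne_e.
have cardM : #|M| = #|Mbar|.+1 by rewrite (cardsD1 (bedge ibar jbar)) ebar_M.
split; first exact: search_terminates.
move=> Mnu /(search_invariant_reaches matMbar sub_ME jbar_free free_jbar).
case=> [[-> noP]|[P [augP subP DMnu matMnu cardMnu]]]; first by split.
split=> [_|[]]; last by exists P.
split; last by exists P.
(* [Mnu] has one edge more than [Mbar], hence as many as [M]. *)
by split=> // M' /maxM; rewrite cardMnu cardM.
Qed.
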